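(* Let $(w^*,\lambda^* )$, $w^*=(x^*,u^* )$, be a KKT point of the optimal control problem (OCP) described in the context that satisfies LICQ and SOSC, and let $y^*=(x^*,x^*,u^* )$. Then the asymptotic linear contraction rate at $y^*$ of the generalized Gauss-Newton (GGN) multiple shooting iterates, obtained via $y^+=\hat\Pi_{\mathrm{MS}}(y)$, is equal to the asymptotic linear contraction rate at $y^*$ of the GGN single shooting iterates, obtained via $y^+=\hat\Pi_{\mathrm{SS}}(y)$.
   Context: OCP. Let $N\ge 1$, $x=(x_0,\dots,x_N)$ with $x_i\in\mathbb{R}^{n_x}$, $u=(u_0,\dots,u_{N-1})$ with $u_i\in\mathbb{R}^{n_u}$, $w=(x,u)$, and let $\bar{\bar x}_0\in\mathbb{R}^{n_x}$ be given. Minimize $V(w)=\sum_{i=0}^{N-1} l_i(x_i,u_i)+l_N(x_N)$ over $w$ subject to $x_0=\bar{\bar x}_0$ and $x_{i+1}=f_i(x_i,u_i)$, $i=0,\dots,N-1$. The functions $l_i$ and $l_N$ are convex. The constraints are written $F(x,u)=0$, where $F(x,u)$ stacks $\bar{\bar x}_0-x_0$ and $f_i(x_i,u_i)-x_{i+1}$, $i=0,\dots,N-1$. The Lagrangian is $V(w)+\lambda^\top F(w)$. A KKT point $(w^*,\lambda^* )$ satisfies $F(w^* )=0$ and $\nabla V(w^* )+\frac{\partial F}{\partial w}(w^* )^\top\lambda^*=0$. LICQ: $\frac{\partial F}{\partial w}(w^* )$ has full row rank. SOSC: the Hessian in $w$ of the Lagrangian at $(w^*,\lambda^* )$ is positive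 definite on the null space of $\frac{\partial F}{\partial w}(w^* )$. Linearization at $\bar w=(\bar x,\bar u)$. For $i=0,\dots,N-1$: $A_i=\frac{\partial f_i}{\partial x_i}(\bar x_i,\bar u_i)$, $B_i=\frac{\partial f_i}{\partial u_i}(\bar x_i,\bar u_i)$, $\bar f_i=f_i(\bar x_i,\bar u_i)$, $a_i=\bar f_i-A_i\bar x_i-B_i\bar u_i$; GGN Hessian blocks $\begin{bmatrix}Q_i&S_i^\top\\S_i&R_i\end{bmatrix}=\nabla^2_{(x_i,u_i)}l_i(\bar x_i,\bar u_i)$; $q_i=\nabla_{x_i}l_i(\bar x_i,\bar u_i)-Q_i\bar x_i-S_i^\top\bar u_i$, $r_i=\nabla_{u_i}l_i(\bar x_i,\bar u_i)-S_i\bar x_i-R_i\bar u_i$; $P_N=\nabla^2 l_N(\bar x_N)$, $p_N=\nabla l_N(\bar x_N)-P_N\bar x_N$. Riccati recursion, for $i=N-1,\dots,0$: $K_i=-(R_i+B_i^\top P_{i+1}B_i)^{-1}(S_i+B_i^\top P_{i+1}A_i)$; $\kappa_i^{0}=-(R_i+B_i^\top P_{i+1}B_i)^{-1}\big(r_i+B_i^\top(P_{i+1}a_i+p_{i+1})\big)$; $P_i=Q_i+A_i^\top P_{i+1}A_i+(S_i^\top+A_i^\top P_{i+1}B_i)K_i$; $p_i=q_i+A_i^\top(P_{i+1}a_i+p_{i+1})+K_i^\top\big(r_i+B_i^\top(P_{i+1}a_i+p_{i+1})\big)$. The resulting affine feedback law of the quadratic subproblem is $u_i=\kappa_i^0+K_ix_i$;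 it is written relative to the linearization point as $u_i=\bar u_i+k_i+K_i(x_i-\bar x_i)$, i.e. $k_i=\kappa^0_i+K_i\bar x_i-\bar u_i$. The $K_i,k_i$ depend on $\bar w$ only. Residual blocks. $\hat F(x,u;\bar w)$ stacks $\bar{\bar x}_0-x_0$ and $\bar f_i+A_i(x_i-\bar x_i)+B_i(u_i-\bar u_i)-x_{i+1}$, $i=0,\dots,N-1$. $G(x,u;\bar w)$ stacks $\bar u_i+k_i(\bar w)+K_i(\bar w)(x_i-\bar x_i)-u_i$, $i=0,\dots,N-1$. Iterations. Let $y=(x,\hat x,u)$, where $\hat x$ has the same dimension as $x$, and $\bar y=(\bar x,\bar{\hat x},\bar u)$, $\bar w=(\bar x,\bar u)$. $\hat\Pi_{\mathrm{SS}}(\bar y)$ is the solution $y$ of $\hat R_{\mathrm{SS}}(y;\bar y)=(F(x,u),\hat F(\hat x,u;\bar w),G(\hat x,u;\bar w))=0$. $\hat\Pi_{\mathrm{MS}}(\bar y)$ is the solution $y$ of $\hat R_{\mathrm{MS}}(y;\bar y)=(\hat F(x,u;\bar w),\hat F(\hat x,u;\bar w),G(\hat x,u;\bar w))=0$. Asymptotic linear contraction rate. For an iteration $z^+=\Pi(z)$ given by $R(\Pi(\bar z);\bar z)=0$ with fixed point $z^*$, it is the spectral radius $\rho(J(z^* ))$ of $J(z^* )=-\big(\frac{\partial R}{\partial z}(z^*;z^* )\big)^{-1}\frac{\partial R}{\partial\bar z}(z^*;z^* )$, which is the derivative of $\Pi$ at $z^*$. Standing assumptions. The matrices inverted in the Riccati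 recursion are invertible at $\bar w=w^*$ (hence nearby), so that the iterations are well defined near the fixed point; the functions $f_i,l_i,l_N$ are smooth enough that the residual maps are twice continuously differentiable near the fixed point. *)

(* Defs.v *)
From HB Require Import structures.
From mathcomp Require Import all_boot all_order all_algebra.
From mathcomp Require Import all_classical all_reals all_analysis.
From mathcomp Require Import complex.

Set Implicit Arguments.
Unset Strict Implicit.
Unset Printing Implicit Defensive.

Import Order.TTheory GRing.Theory Num.Theory.
Import numFieldNormedType.Exports.

Local Open Scope classical_set_scope.
Local Open Scope ring_scope.

(** * Derivatives of functions of a column vector *)

Section Calculus.
Context {R : realType}.

(* Column-vector counterpart of ['J f p], which acts on row vectors. *)
Definition jac n m (f : 'cV[R]_n -> 'cV[R]_m) (z : 'cV[R]_n) : 'M[R]_(m, n) :=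
  \matrix_(i, j) ('d f z (delta_mx j 0)) i 0.

Definition grad n (g : 'cV[R]_n -> R) (z : 'cV[R]_n) : 'cV[R]_n :=
  \col_j 'd g z (delta_mx j 0).

Definition hess n (g : 'cV[R]_n -> R) (z : 'cV[R]_n) : 'M[R]_n :=
  jac (grad g) z.

(* Continuity of all directional derivatives is continuity of the differential,
   since these definitions are only used on finite-dimensional domains. *)
Definition C1_near (V W : normedModType R) (f : V -> W) (z : V) : Prop :=
  \forall t \near z, differentiable f t /\ forall v, {for t, continuous ('D_v f)}.

Definition C2_near (V W : normedModType R) (f : V -> W) (z : V) : Prop :=
  C1_near f z /\ forall v, C1_near ('D_v f) z.

Definition posdef_on_kernel m n (D : 'M[R]_(m, n)) (H : 'M[R]_n) : Prop :=
  forall d : 'cV[R]_n, D *m d = 0 -> d != 0 -> 0 < (d^T *m H *m d) 0 0.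

(* Largest modulus of a complex eigenvalue (0 in dimension 0). *)
Definition spectral_radius n (A : 'M[R]_n) : R :=
  sup [set ComplexField.Normc.normc a | a in
    [set a : R[i] | eigenvalue (map_mx (real_complex R) A) a]].

End Calculus.

(** * Iterations defined implicitly by a residual [res z zb] *)

Section Iteration.
Context {R : realType} {n : nat}.
Implicit Types (res : 'cV[R]_n -> 'cV[R]_n -> 'cV[R]_n) (z zb : 'cV[R]_n).

Definition solution_map res zb : 'cV[R]_n := get [set z | res z zb = 0].

Definition jac_unknown res z : 'M[R]_n := jac (fun t => res t z) z.
Definition jac_param res z : 'M[R]_n := jac (fun t => res z t) z.

Definition iteration_jac res z : 'M[R]_n :=
  - invmx (jac_unknown res z) *m jac_param res z.

Definition contraction_rate res z : R := spectral_radius (iteration_jac res z).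

(* What [contraction_rate] presupposes: near [z] the solution defining the next
   iterate exists and is unique, [z] is a fixed point, and the matrix inverted
   in [iteration_jac] is invertible. *)
Definition well_posed_at res z : Prop :=
  [/\ \forall zb \near z, forall t, res t zb = 0 <-> t = solution_map res zb,
      solution_map res z = z
    & jac_unknown res z \in unitmx].

End Iteration.

(** * The optimal control problem *)

(* Dynamics and stage costs take the stacked argument [col_mx x_i u_i]. *)
Record ocp (R : realType) (N nx nu : nat) := OCP {
  dyn : 'I_N -> 'cV[R]_(nx + nu) -> 'cV[R]_nx;
  stage_cost : 'I_N -> 'cV[R]_(nx + nu) -> R;
  final_cost : 'cV[R]_nx -> R;
  x_init : 'cV[R]_nx
}.

Section OCP.
Context {R : realType} {N nx nu : nat} (P : ocp R N nx nu).

(* Trajectories are stacked into single columns with blocks [submxcol _ i];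
   [w = col_mx x u] and [y = col_mx x (col_mx xhat u)]. *)
Local Notation nX := (\sum_(i < N.+1) nx)%N.
Local Notation nU := (\sum_(i < N) nu)%N.
Local Notation nW := (nX + nU)%N.
Local Notation nY := (nX + (nX + nU))%N.

Implicit Types (i : 'I_N) (w wb : 'cV[R]_nW) (y yb : 'cV[R]_nY).

Definition state w (j : 'I_N.+1) : 'cV[R]_nx := submxcol (usubmx w) j.
Definition control w i : 'cV[R]_nu := submxcol (dsubmx w) i.

Definition cur i : 'I_N.+1 := widen_ord (leqnSn N) i.
Definition next i : 'I_N.+1 := lift ord0 i.

Definition x_ w i : 'cV[R]_nx := state w (cur i).
Definition xu_ w i : 'cV[R]_(nx + nu) := col_mx (x_ w i) (control w i).

(* Block 0 holds the initial condition, block [i + 1] the [i]-th dynamics. *)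
Definition stack_constraints (c0 : 'cV[R]_nx) (c : 'I_N -> 'cV[R]_nx) :
    'cV[R]_nX :=
  \mxcol_(j < N.+1) (if unlift ord0 j is Some i then c i else c0).

Definition V w : R :=
  \sum_(i < N) stage_cost P i (xu_ w i) + final_cost P (state w ord_max).

Definition F w : 'cV[R]_nX :=
  stack_constraints (x_init P - state w ord0)
    (fun i => dyn P i (xu_ w i) - state w (next i)).

Definition lagrangian (lam : 'cV[R]_nX) w : R := V w + (lam^T *m F w) 0 0.

Definition KKT w (lam : 'cV[R]_nX) : Prop :=
  F w = 0 /\ grad V w + (jac F w)^T *m lam = 0.

Definition LICQ w : Prop := row_free (jac F w).

Definition SOSC w (lam : 'cV[R]_nX) : Prop :=
  posdef_on_kernel (jac F w) (hess (lagrangian lam) w).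

Definition smooth_data w : Prop :=
  (forall i, C2_near (dyn P i) (xu_ w i) /\ C2_near (stage_cost P i) (xu_ w i))
  /\ C2_near (final_cost P) (state w ord_max).

(** ** Linear-quadratic approximation at [wb] *)

Definition A_ wb i : 'M[R]_nx := lsubmx (jac (dyn P i) (xu_ wb i)).
Definition B_ wb i : 'M[R]_(nx, nu) := rsubmx (jac (dyn P i) (xu_ wb i)).
Definition fbar_ wb i : 'cV[R]_nx := dyn P i (xu_ wb i).
Definition a_ wb i : 'cV[R]_nx :=
  fbar_ wb i - A_ wb i *m x_ wb i - B_ wb i *m control wb i.

(* Blocks of the Hessian [Q S^T; S R] of the stage cost. *)
Definition Q_ wb i : 'M[R]_nx := ulsubmx (hess (stage_cost P i) (xu_ wb i)).
Definition S_ wb i : 'M[R]_(nu, nx) :=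
  dlsubmx (hess (stage_cost P i) (xu_ wb i)).
Definition R_ wb i : 'M[R]_nu := drsubmx (hess (stage_cost P i) (xu_ wb i)).
Definition q_ wb i : 'cV[R]_nx :=
  usubmx (grad (stage_cost P i) (xu_ wb i))
  - Q_ wb i *m x_ wb i - (S_ wb i)^T *m control wb i.
Definition r_ wb i : 'cV[R]_nu :=
  dsubmx (grad (stage_cost P i) (xu_ wb i))
  - S_ wb i *m x_ wb i - R_ wb i *m control wb i.

Definition P_final wb : 'M[R]_nx := hess (final_cost P) (state wb ord_max).
Definition p_final wb : 'cV[R]_nx :=
  grad (final_cost P) (state wb ord_max) - P_final wb *m state wb ord_max.

(** ** Riccati recursion; [Pp] is the pair (P_{i+1}, p_{i+1}) *)

Definition ric_mx wb i (Pp : 'M[R]_nx * 'cV[R]_nx) : 'M[R]_nu :=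
  R_ wb i + (B_ wb i)^T *m Pp.1 *m B_ wb i.

Definition ric_gain wb i (Pp : 'M[R]_nx * 'cV[R]_nx) : 'M[R]_(nu, nx) :=
  - invmx (ric_mx wb i Pp) *m (S_ wb i + (B_ wb i)^T *m Pp.1 *m A_ wb i).

Definition ric_offset wb i (Pp : 'M[R]_nx * 'cV[R]_nx) : 'cV[R]_nu :=
  - invmx (ric_mx wb i Pp)
    *m (r_ wb i + (B_ wb i)^T *m (Pp.1 *m a_ wb i + Pp.2)).

Definition ric_step wb i (Pp : 'M[R]_nx * 'cV[R]_nx) :
    'M[R]_nx * 'cV[R]_nx :=
  (Q_ wb i + (A_ wb i)^T *m Pp.1 *m A_ wb i
     + ((S_ wb i)^T + (A_ wb i)^T *m Pp.1 *m B_ wb i) *m ric_gain wb i Pp,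
   q_ wb i + (A_ wb i)^T *m (Pp.1 *m a_ wb i + Pp.2)
     + (ric_gain wb i Pp)^T
       *m (r_ wb i + (B_ wb i)^T *m (Pp.1 *m a_ wb i + Pp.2))).

(* (P_j, p_j): fold of the step over the stages j, ..., N - 1, starting from
   the terminal pair; see [riccatiN] and [riccatiS]. *)
Definition riccati wb (j : nat) : 'M[R]_nx * 'cV[R]_nx :=
  foldr (ric_step wb) (P_final wb, p_final wb) (drop j (enum 'I_N)).

Lemma riccatiN wb : riccati wb N = (P_final wb, p_final wb).
Proof. by rewrite /riccati drop_oversize // size_enum_ord. Qed.

Lemma riccatiS wb i : riccati wb i = ric_step wb i (riccati wb i.+1).
Proof.
by rewrite /riccati (drop_nth i) ?size_enum_ord //= nth_ord_enum.
Qed.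

Definition Lambda_ wb i : 'M[R]_nu := ric_mx wb i (riccati wb i.+1).
Definition K_ wb i : 'M[R]_(nu, nx) := ric_gain wb i (riccati wb i.+1).
Definition kappa0_ wb i : 'cV[R]_nu := ric_offset wb i (riccati wb i.+1).
Definition k_ wb i : 'cV[R]_nu :=
  kappa0_ wb i + K_ wb i *m x_ wb i - control wb i.

(** ** Residuals *)

Definition Fhat w wb : 'cV[R]_nX :=
  stack_constraints (x_init P - state w ord0)
    (fun i => fbar_ wb i + A_ wb i *m (x_ w i - x_ wb i)
              + B_ wb i *m (control w i - control wb i) - state w (next i)).

Definition G w wb : 'cV[R]_nU :=
  \mxcol_(i < N) (control wb i + k_ wb i + K_ wb i *m (x_ w i - x_ wb i)
                  - control w i).

Definition w_of y : 'cV[R]_nW := col_mx (usubmx y) (dsubmx (dsubmx y)).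
Definition what_of y : 'cV[R]_nW := dsubmx y.
Definition y_of w : 'cV[R]_nY := col_mx (usubmx w) w.

Definition R_SS y yb : 'cV[R]_nY :=
  col_mx (F (w_of y))
    (col_mx (Fhat (what_of y) (w_of yb)) (G (what_of y) (w_of yb))).

Definition R_MS y yb : 'cV[R]_nY :=
  col_mx (Fhat (w_of y) (w_of yb))
    (col_mx (Fhat (what_of y) (w_of yb)) (G (what_of y) (w_of yb))).

End OCP.

(* Main.v *)
From HB Require Import structures.
Require Import Defs.
From mathcomp Require Import all_boot all_order all_algebra.
From mathcomp Require Import all_classical all_reals all_analysis.
From mathcomp Require Import ring.
Import Order.TTheory GRing.Theory Num.Theory.
Import numFieldNormedType.Exports.
Local Open Scope classical_set_scope.
Local Open Scope ring_scope.

(* R_MS and R_SS differ only in their first block, Fhat(x, u; wb) against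
   F(x, u). At ystar these blocks have the same derivative in the unknown, and
   the derivative of f(wb) + J(wb)(wstar - wb) in wb vanishes at wb = wstar, just
   like that of the constant F(wstar). Hence the two iteration Jacobians are
   equal, and no spectral argument is needed.

   ystar is a fixed point because backward induction on the KKT conditions gives
   lambda_j = P_j x_j + p_j, so that the Riccati feedback reproduces the optimal
   controls, i.e. k(wstar) = 0; this uses the symmetry of the Hessians (Schwarz).

   Simulating the closed loop forward in time shows that each residual has
   exactly one zero. The derivative of both residuals in the unknown is itself a
   residual of this kind, so its kernel is trivial and it is invertible. *)

Set Implicit Arguments.
Unset Strict Implicit.
Unset Printing Implicit Defensive.

(** * Directional derivatives *)

Section DirectionalDerivatives.
Context {R : realType}.

(** The first-order expansion of [f] at [z] is also one of [g], and [diff_unique] then identifies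
    the two differentials. This serves functions such as [grad g], which have a tractable formula
    only near a point. *)
Lemma near_eq_differentiable (V W : normedModType R) (f g : V -> W) (z : V) :
  {near z, f =1 g} -> differentiable f z -> differentiable g z.
Proof.
move=> fg /[dup] df /diff_locallyP [dfc dfo].
have go : g \o shift z = cst (g z) + 'd f z +o_ 0 id.
  apply/eqaddoP => e e0.
  have /eqaddoP /(_ e e0) := dfo.
  apply: filter_app.
  have : \forall h \near (0 : V), f (h + z) = g (h + z).
    have := fg; rewrite (near_shift 0 z) /=.
    by apply: filterS => h /=; rewrite subr0.
  apply: filterS => h /= fgh.
  rewrite -![(_ + _ : _ -> _) _]/(_ + _) -![(- _ : _ -> _) _]/(- _) /=.
  by rewrite -![(_ + _ : _ -> _) _]/(_ + _) /= fgh (nbhs_singleton fg).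
have dgE : 'd g z = 'd f z :> (V -> W) by exact: diff_unique.
apply/diff_locallyP; split; first by rewrite dgE.
by rewrite dgE.
Qed.

(** Expanding the argument in the canonical basis writes [L] as a finite sum of scaled coordinate
    functions. *)
Lemma continuous_linear_cV n (W : normedModType R)
    (L : {linear 'cV[R]_n -> W}) :
  continuous L.
Proof.
have -> : (L : 'cV[R]_n -> W) = (fun u => \sum_j u j 0 *: L (delta_mx j 0)).
  apply/funext => u.
  rewrite {1}[u]matrix_sum_delta linear_sum; apply: eq_bigr => j _.
  by rewrite big_ord1 linearZ.
apply: continuous_big => [|j _ u]; first exact: add_continuous.
have cu := @coord_continuous R n 1 j 0 u.
exact: (@cvgZr_tmp _ _ _ _ _ _ _ _ cu).
Qed.

Lemma differentiable_linear_cV n (W : normedModType R) (L : 'cV[R]_n -> W) z :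
  linear L -> differentiable L z.
Proof.
move=> lL.
pose LM := GRing.isLinear.Build _ _ _ _ _ lL.
pose LL : {linear 'cV[R]_n -> W} := HB.pack L LM.
apply: (@linear_differentiable _ _ _ LL).
exact: continuous_linear_cV.
Qed.

(* Directional derivatives see a linear change of variables purely
   algebraically, so no continuity of [L] is needed. *)
Lemma is_derive_comp_linear (U V W : normedModType R) (L : U -> V) (f : V -> W)
    z v df :
  linear L -> is_derive (L z) (L v) f df -> is_derive z v (f \o L) df.
Proof.
move=> lL.
have E : (fun h : R => h^-1 *: (((f \o L) \o shift z) (h *: v) - (f \o L) z)) =
         (fun h : R => h^-1 *: ((f \o shift (L z)) (h *: L v) - f (L z))).
  by apply/funext => h /=; rewrite lL.
by case=> ex <-; split; rewrite /derivable /derive E.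
Qed.

Lemma is_derive_linear_cV n (W : normedModType R) (L : 'cV[R]_n -> W) z v :
  linear L -> is_derive z v L (L v).
Proof.
move=> lL; apply: (@is_derive_comp_linear _ _ _ L id z v (L v)) => //.
Qed.

Lemma is_derive_affine n (W : normedModType R) (f L : 'cV[R]_n -> W) c z v :
  (forall t, f t = c + L t) -> linear L -> is_derive z v f (L v).
Proof.
move=> fE lL; rewrite (_ : f = cst c + L); last exact/funext.
rewrite -[L v]add0r; apply: is_deriveD; exact: is_derive_linear_cV.
Qed.

Lemma linear_addf (U W : lmodType R) (f g : U -> W) :
  linear f -> linear g -> linear (fun t => f t + g t).
Proof. by move=> lf lg a u v; rewrite lf lg scalerDr addrACA. Qed.

Lemma linear_oppf (U W : lmodType R) (f : U -> W) :
  linear f -> linear (fun t => - f t).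
Proof. by move=> lf a u v; rewrite lf opprD scalerN. Qed.

Lemma linear_mulmxf (U : lmodType R) m n p (A : 'M[R]_(m, n))
    (f : U -> 'M[R]_(n, p)) :
  linear f -> linear (fun t => A *m f t).
Proof. by move=> lf a u v; rewrite lf mulmxDr scalemxAr. Qed.

Lemma is_derive_mxP (V : normedModType R) m n (M : V -> 'M[R]_(m, n)) z v
    (dM : 'M[R]_(m, n)) :
  is_derive z v M dM <->
  forall i j, is_derive z v (fun t => M t i j) (dM i j).
Proof.
split=> [[Mz <-] i j|H].
  split; first exact: ((derivable_mxP M z v).1 Mz i j).
  by rewrite derive_mx // mxE.
have Mz : derivable M z v.
  by apply: (derivable_mxP M z v).2 => i j; have [] := H i j.
split => //; rewrite derive_mx //; apply/matrixP => i j; rewrite mxE.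
by have [] := H i j.
Qed.

Lemma is_derive_col_mx (V : normedModType R) m1 m2 (f : V -> 'cV[R]_m1)
    (g : V -> 'cV[R]_m2) z v (df : 'cV[R]_m1) (dg : 'cV[R]_m2) :
  is_derive z v f df -> is_derive z v g dg ->
  is_derive z v (fun t => col_mx (f t) (g t)) (col_mx df dg).
Proof.
move=> /is_derive_mxP Hf /is_derive_mxP Hg; apply/is_derive_mxP => i j.
have [k ->|k ->] := split_ordP i.
  by rewrite col_mxEu; under eq_fun do rewrite col_mxEu.
by rewrite col_mxEd; under eq_fun do rewrite col_mxEd.
Qed.

Lemma is_derive_mxcol (V : normedModType R) p (q : 'I_p -> nat)
    (f : V -> forall i, 'cV[R]_(q i)) z v
    (df : forall i, 'cV[R]_(q i)) :
  (forall i, is_derive z v (fun t => f t i) (df i)) ->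
  is_derive z v (fun t => \mxcol_i f t i) (\mxcol_i df i).
Proof.
move=> H; apply/is_derive_mxP => i j.
rewrite [X in is_derive _ _ _ X]mxE; under eq_fun do rewrite mxE.
by have /is_derive_mxP := H (tagnat.sig1 i); apply.
Qed.

Lemma jac_mulmx n m (f : 'cV[R]_n -> 'cV[R]_m) z v :
  differentiable f z -> jac f z *m v = 'D_v f z.
Proof.
move=> df; rewrite (deriveE _ df).
apply/colP => i; rewrite !mxE.
rewrite {2}[v]matrix_sum_delta linear_sum summxE.
apply: eq_bigr => j _; rewrite !mxE big_ord1 linearZ !mxE mulrC; congr (_ * _).
Qed.

(** Reduces the comparison of Jacobians to directional derivatives, the only derivatives computed
    explicitly for the residuals. *)
Lemma jac_eq n m (f g : 'cV[R]_n -> 'cV[R]_m) z :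
  differentiable f z -> differentiable g z ->
  (forall v, 'D_v f z = 'D_v g z) -> jac f z = jac g z.
Proof.
move=> df dg H; apply/matrixP => i j; rewrite [LHS]mxE [RHS]mxE.
have E := etrans (esym (deriveE (delta_mx j 0) df))
                 (etrans (H (delta_mx j 0)) (deriveE (delta_mx j 0) dg)).
exact: (congr1 (fun M : 'cV[R]_m => M i 0) E).
Qed.

Lemma grad_mulmx n (g : 'cV[R]_n -> R) z v :
  differentiable g z -> ((grad g z)^T *m v) 0 0 = 'D_v g z.
Proof.
move=> dg; rewrite (deriveE _ dg) mxE.
rewrite {2}[v]matrix_sum_delta linear_sum.
by apply: eq_bigr => j _; rewrite !mxE big_ord1 linearZ mulrC.
Qed.

End DirectionalDerivatives.

(** * Symmetry of the Hessian *)

Section Schwarz.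
Context {R : realType} {V : normedModType (R : numFieldType)}.
Implicit Types (g : V -> R) (z u v : V).

Lemma is_derive_along_line (W : normedModType R) (g : V -> W) u b (s : R) :
  derivable g (s *: u + b) u ->
  is_derive s (1 : R) (fun s : R => g (s *: u + b)) ('D_u g (s *: u + b)).
Proof.
have E : (fun h : R => h^-1 *: ((g \o shift (s *: u + b)) (h *: u)
                                  - g (s *: u + b))) =
    (fun h : R => h^-1 *: (((fun s : R => g (s *: u + b)) \o shift s)
                             (h *: (1 : R)) - g (s *: u + b))).
  by apply/funext => h /=; rewrite scalerDl addrA [_ *: 1]mulr1.
by move=> dg; split; rewrite ?/derivable ?/derive -E.
Qed.

Lemma mean_value_line (f df : R -> R) (h : R) : 0 < h ->
  (forall s, 0 <= s <= h -> is_derive s (1 : R) f (df s)) ->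
  exists2 c, 0 <= c <= h & f h - f 0 = h * df c.
Proof.
move=> h0 H.
have [||c ch E] := @MVT R f df 0 h h0.
- by move=> x; rewrite in_itv /= => /andP[x0 xh]; apply: H; rewrite !ltW.
- apply: derivable_within_continuous => x; rewrite in_itv /= => /H [].
  by [].
exists c; last by rewrite E subr0 mulrC.
by move: ch; rewrite in_itv /= => /andP[c0 ch]; rewrite !ltW.
Qed.

(** Two uses of the mean value theorem: along [u] for the difference of [g] on two parallel
    segments, then along [v] for ['D_u g]. The second difference on the left is symmetric in [u] and
    [v], the right side is not visibly so. *)
Lemma second_difference_mean_value g z u v (h : R) : 0 < h ->
  (forall s t : R, 0 <= s <= h -> 0 <= t <= h ->
    differentiable g (s *: u + (t *: v + z)) /\
    differentiable ('D_u g) (s *: u + (t *: v + z))) ->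
  exists c d : R, [/\ 0 <= c <= h, 0 <= d <= h &
    g (h *: u + (h *: v + z)) - g (h *: u + z) - (g (h *: v + z) - g z)
      = h * (h * 'D_v ('D_u g) (c *: u + (d *: v + z)))].
Proof.
move=> h0 H.
have z0h : 0 <= (0 : R) <= h by rewrite lexx ltW.
have hh : 0 <= h <= h by rewrite lexx ltW.
pose f s := g (s *: u + (h *: v + z)) - g (s *: u + z).
pose df s := 'D_u g (s *: u + (h *: v + z)) - 'D_u g (s *: u + z).
have [|c ch E1] := @mean_value_line f df h h0.
  move=> s sh; apply: is_deriveB; apply: is_derive_along_line.
    by apply: diff_derivable; have [] := H s h sh hh.
  have [+ _] := H s 0 sh z0h; rewrite scale0r add0r => ?.
  exact: diff_derivable.
pose k t := 'D_u g (t *: v + (c *: u + z)).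
pose dk t := 'D_v ('D_u g) (t *: v + (c *: u + z)).
have [|d dh E2] := @mean_value_line k dk h h0.
  move=> t th; apply: is_derive_along_line; apply: diff_derivable.
  by rewrite addrCA; have [] := H c t ch th.
exists c, d; split=> //.
move: E1 E2; rewrite /f /df /k /dk !scale0r !add0r => -> E2.
by rewrite [in X in h * (X - _)]addrCA E2 [in 'D_v _ _]addrCA.
Qed.

Lemma near_parallelogram z u v (A : set V) : (\near z, A z) ->
  \forall h \near (0 : R)^'+, forall s t : R, 0 <= s <= h -> 0 <= t <= h ->
    A (s *: u + (t *: v + z)).
Proof.
move=> /nbhs_normP [e /= e0 eA].
(* The [+ 1] keeps the later divisor positive when [u] and [v] both vanish. *)
have M0 : 0 < `|u| + `|v| + 1 by rewrite ltr_wpDl // addr_ge0.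
near=> h => s t /andP[s0 sh] /andP[t0 th]; apply: eA => /=.
rewrite addrA opprD addrCA subrr addr0 normrN.
have h0 : 0 < h by near: h; exact: nbhs_right_gt.
apply: (@le_lt_trans _ _ (h * (`|u| + `|v|))).
  rewrite mulrDr (le_trans (ler_normD _ _)) // !normrZ !ger0_norm //.
  by rewrite lerD // ler_wpM2r.
apply: (@lt_trans _ _ (h * (`|u| + `|v| + 1))).
  by rewrite ltr_pM2l // ltrDl.
rewrite -ltr_pdivlMr //; near: h; apply: nbhs_right_lt.
by rewrite divr_gt0.
Unshelve. all: by end_near. Qed.

Lemma dist_le_halves (a b m m' e : R) : m = m' ->
  `|a - m| < e / 2 -> `|b - m'| < e / 2 -> `|b - a| <= e.
Proof.
move=> -> am bm; apply: le_trans (ler_distD m' _ _) _.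
by rewrite [e]splitr lerD // ltW // distrC.
Qed.

(** The same second difference is expressed by both mixed derivatives, each at some point of a small
    parallelogram. By continuity these values are close to those at [z], so the two derivatives at
    [z] differ by at most any [e > 0]. *)
Lemma derive_derive_sym g z u v : C2_near g z ->
  'D_u ('D_v g) z = 'D_v ('D_u g) z.
Proof.
move=> [C1g C2g].
have cont w w' (e : R) : 0 < e -> \forall x \near z,
    `|'D_w' ('D_w g) z - 'D_w' ('D_w g) x| < e.
  move=> e0; have [_ /(_ w')] := nbhs_singleton (C2g w).
  by move=> /cvgrPdist_lt; apply.
have diffD w : \forall x \near z, differentiable ('D_w g) x.
  by have := C2g w; apply: filterS => x [].
have diffg : \forall x \near z, differentiable g x.
  by move: C1g; apply: filterS => x [].
apply/eqP; rewrite -subr_eq0 -normr_le0; apply/ler_addgt0Pr => e e0.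
rewrite add0r.
have e20 : 0 < e / 2 by rewrite divr_gt0.
pose A : set V := [set x : V | [/\ differentiable g x,
  differentiable ('D_u g) x,
  differentiable ('D_v g) x, `|'D_v ('D_u g) z - 'D_v ('D_u g) x| < e / 2
  & `|'D_u ('D_v g) z - 'D_u ('D_v g) x| < e / 2]].
have nA : \forall x \near z, A x.
  move: diffg; apply: filter_app; move: (diffD u); apply: filter_app.
  move: (diffD v); apply: filter_app; move: (cont u v _ e20).
  apply: filter_app; move: (cont v u _ e20).
  by apply: filterS => x.
have [h [h0 Auv Avu]] : exists h : R, [/\ 0 < h,
    forall s t : R, 0 <= s <= h -> 0 <= t <= h -> A (s *: u + (t *: v + z)) &
    forall s t : R, 0 <= s <= h -> 0 <= t <= h -> A (s *: v + (t *: u + z))].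
  apply: (@filter_ex _ (0 : R)^'+).
  move: (near_parallelogram u v nA); apply: filter_app.
  move: (near_parallelogram v u nA); apply: filter_app.
  by move: (nbhs_right_gt (0 : R)); apply: filterS => h.
have [|c [d [ch dh E1]]] := @second_difference_mean_value g z u v h h0.
  by move=> s t sh th; have [] := Auv s t sh th.
have [|c' [d' [c'h d'h E2]]] := @second_difference_mean_value g z v u h h0.
  by move=> s t sh th; have [] := Avu s t sh th.
have [_ _ _ Eu _] := Auv _ _ ch dh; have [_ _ _ _ Ev] := Avu _ _ c'h d'h.
(* Both sides times [h * h] equal the second difference, so [h] is cancelled twice. *)
have E : 'D_v ('D_u g) (c *: u + (d *: v + z)) =
         'D_u ('D_v g) (c' *: v + (d' *: u + z)).
  apply: (mulfI (lt0r_neq0 h0)); apply: (mulfI (lt0r_neq0 h0)).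
  apply: etrans (esym E1) (etrans _ E2).
  by rewrite [h *: v + (_ + _)]addrCA opprD addrACA -opprD.
exact: dist_le_halves E Eu Ev.
Qed.

End Schwarz.

Section Hessian.
Context {R : realType} {n : nat}.

(** [grad] is built from differentials, which agree with directional derivatives where [g] is
    differentiable; hence an identity near [z], oriented for [near_eq_differentiable]. *)
Lemma grad_nearE (g : 'cV[R]_n -> R) (z : 'cV[R]_n) :
  (\forall t \near z, differentiable g t) ->
  \forall t \near z,
    \sum_j 'D_(delta_mx j 0) g t *: delta_mx j 0 = grad g t.
Proof.
apply: filterS => t dg; apply/colP => i.
rewrite summxE mxE (bigD1 i) //= !mxE !eqxx mulr1 big1 ?addr0.
  exact: deriveE.
by move=> j ji; rewrite !mxE eq_sym (negPf ji) mulr0.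
Qed.

Lemma hess_derive (g : 'cV[R]_n -> R) (z : 'cV[R]_n) i j : C2_near g z ->
  hess g z i j = 'D_(delta_mx j 0) ('D_(delta_mx i 0) g) z.
Proof.
move=> [C1g C2g].
have ng : \forall t \near z, differentiable g t.
  by move: C1g; apply: filterS => t [].
(* [G] is differentiable because [C2_near] speaks of directional derivatives; the differentiability
   of [grad g] is then inherited from it. *)
pose G := fun t => \sum_k 'D_(delta_mx k 0) g t *: (delta_mx k 0 : 'cV[R]_n).
have dG : differentiable G z.
  have -> : G = \sum_k (fun t => 'D_(delta_mx k 0) g t *: delta_mx k 0).
    by apply/funext => t; rewrite fct_sumE.
  apply: differentiable_sum => k; apply: differentiableZl.
  by have [] := nbhs_singleton (C2g (delta_mx k 0)).
have dgrad := near_eq_differentiable (grad_nearE ng) dG.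
have /(congr1 (fun M : 'cV[R]_n => M i 0)) := deriveE (delta_mx j 0) dgrad.
rewrite [LHS]/= derive_mx ?mxE; last exact: diff_derivable.
move=> E; apply: etrans (esym E) _; apply: near_eq_derive.
move: ng; apply: filterS => t dg.
by rewrite mxE; exact/esym/deriveE.
Qed.

Lemma hess_sym (g : 'cV[R]_n -> R) z : C2_near g z -> (hess g z)^T = hess g z.
Proof.
move=> C2g; apply/matrixP => i j.
rewrite [LHS]mxE; apply: etrans (hess_derive j i C2g) _.
exact: etrans (derive_derive_sym _ _ C2g) (esym (hess_derive i j C2g)).
Qed.

End Hessian.

(** * Linearization at a moving point *)

Section Linearization.
Context {R : realType} {n m : nat}.

Lemma C1_near_differentiable (V W : normedModType R) (f : V -> W) z :
  C1_near f z -> differentiable f z.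
Proof. by move=> /nbhs_singleton []. Qed.

(** Difference quotient at [z] of [t |-> J(t) (z - t)], with [J] and [J0] its matrices at the
    shifted and unshifted points. *)
Lemma shift_quotient (J J0 : 'M[R]_(m, n)) (z v : 'cV[R]_n) (h : R) : h != 0 ->
  h^-1 *: (J *m (z - (h *: v + z)) - J0 *m (z - z)) = - (J *m v).
Proof.
move=> h0; rewrite subrr mulmx0 subr0 opprD addrCA subrr addr0.
by rewrite mulmxN -scalemxAr scalerN scalerA mulVf // scale1r.
Qed.

(* To first order, moving the linearization point changes nothing at the point
   itself. *)
Lemma is_derive_linearization_point (f : 'cV[R]_n -> 'cV[R]_m) z v :
  C1_near f z -> is_derive z v (fun t => f t + jac f t *m (z - t)) 0.
Proof.
move=> C1f; have df := C1_near_differentiable C1f.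
have -> : (0 : 'cV[R]_m) = 'D_v f z + - 'D_v f z by rewrite subrr.
apply: is_deriveD; first exact/derivableP/diff_derivable.
have cs : h *: v + z @[h --> (0 : R)^'] --> z.
  apply: cvg_within_filter.
  have := @cvgD _ _ _ (nbhs (0 : R)) _ (fun h : R => h *: v) (cst z) (0 *: v) z
    (@scalel_continuous R _ v 0) (cvg_cst z).
  rewrite scale0r add0r; exact.
have cl : - 'D_v f (h *: v + z) @[h --> (0 : R)^'] --> - 'D_v f z.
  apply: cvgN; have [_ /(_ v) cf] := nbhs_singleton C1f.
  exact: cvg_comp cs cf.
have nh : \forall h \near (0 : R)^', differentiable f (h *: v + z).
  have nf : nbhs z [set t | differentiable f t].
    by move: C1f; apply: filterS => t [].
  exact: (cs _ nf).
(* The factor [z - t] vanishes at [z], so the quotient is exactly [- 'D_v f] at the shifted point: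
   continuity of ['D_v f] gives the limit without differentiating [jac f]. *)
have nE : \forall h \near (0 : R)^', - 'D_v f (h *: v + z) =
   h^-1 *: (jac f (h *: v + z) *m (z - (h *: v + z))
       - jac f z *m (z - z)).
  move: nh; apply: filter_app; move: (nbhs_dnbhs_neq (0 : R)).
  apply: filterS => h h0 dfh.
  apply: etrans (congr1 -%R (esym (jac_mulmx v dfh))) _.
  exact/esym/shift_quotient.
pose g (t : 'cV[R]_n) := jac f t *m (z - t).
have lim : h^-1 *: ((g \o shift z) (h *: v) - g z) @[h --> (0 : R)^'] -->
    - 'D_v f z.
  exact: cvg_trans (near_eq_cvg nE) cl.
split; first exact: (cvgP _ lim).
exact: cvg_lim.
Qed.

End Linearization.

(* Importing MathComp after [Defs] leaves [next] to [path.next]. *)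
Local Notation next := Defs.next.

(** * Unique solvability by forward simulation *)

Section ForwardSimulation.
Context {R : realType} {N nx nu : nat}.
Local Notation nX := (\sum_(i < N.+1) nx)%N.
Local Notation nU := (\sum_(i < N) nu)%N.
Local Notation nW := (nX + nU)%N.
Local Notation nY := (nX + (nX + nU))%N.
Implicit Types (i : 'I_N) (j : 'I_N.+1) (w v : 'cV[R]_nW) (y : 'cV[R]_nY).

Lemma ordS_caseP j : j = ord0 \/ exists i : 'I_N, j = next i.
Proof. by case: (unliftP ord0 j) => [i ->|->]; [right; exists i|left]. Qed.

Lemma submxcol_stack0 c0 (c : 'I_N -> 'cV[R]_nx) :
  submxcol (stack_constraints c0 c) ord0 = c0.
Proof. by rewrite /stack_constraints mxcolK unlift_none. Qed.

Lemma submxcol_stack_next c0 (c : 'I_N -> 'cV[R]_nx) i :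
  submxcol (stack_constraints c0 c) (next i) = c i.
Proof. by rewrite /stack_constraints mxcolK liftK. Qed.

Lemma stack_constraints_eq0 c0 (c : 'I_N -> 'cV[R]_nx) :
  stack_constraints c0 c = 0 <-> c0 = 0 /\ forall i, c i = 0.
Proof.
split=> [E|[E0 E]].
  split; first by rewrite -(submxcol_stack0 c0 c) E submxcol0.
  by move=> i; rewrite -(submxcol_stack_next c0 c i) E submxcol0.
apply/mxcolP => j; rewrite submxcol0.
by have [->|[i ->]] := ordS_caseP j;
  rewrite ?submxcol_stack0 ?submxcol_stack_next.
Qed.

Lemma mulmx_tr_stack (lam : 'cV[R]_nX) c0 (c : 'I_N -> 'cV[R]_nx) :
  lam^T *m stack_constraints c0 c =
  (submxcol lam ord0)^T *m c0 + \sum_(i < N) (submxcol lam (next i))^T *m c i.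
Proof.
rewrite -{1}[lam]submxcolK tr_mxcol mul_mxrow_mxcol big_ord_recl.
rewrite unlift_none; congr (_ + _); apply: eq_bigr => i _.
by rewrite liftK.
Qed.

Lemma y_eqE y (x xh : 'cV[R]_nX) (u : 'cV[R]_nU) :
  y = col_mx x (col_mx xh u) <->
  [/\ usubmx y = x, usubmx (dsubmx y) = xh & dsubmx (dsubmx y) = u].
Proof.
split=> [->|[<- <- <-]]; last by rewrite !vsubmxK.
by rewrite col_mxKu col_mxKd col_mxKu col_mxKd.
Qed.

(** Recursion on a bare natural number, with [insub] recovering the stage. The default [0] occurs
    only for times beyond [N], which no trajectory index reaches. *)
Fixpoint simulate (g : 'I_N -> 'cV[R]_nx -> 'cV[R]_nx) (x0 : 'cV[R]_nx)
    (k : nat) : 'cV[R]_nx :=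
  if k is k'.+1 then
    if insub k' is Some i then g i (simulate g x0 k') else 0
  else x0.

Lemma simulate_unique g x0 (X : 'cV[R]_nX) :
  (submxcol X ord0 = x0 /\
   forall i, submxcol X (next i) = g i (submxcol X (cur i))) <->
  X = \mxcol_(j < N.+1) simulate g x0 j.
Proof.
split=> [[X0 XS]|->]; last first.
  by split=> [|i]; rewrite !mxcolK //= valK.
apply/mxcolP => j; rewrite mxcolK.
(* The bound on [k] stays quantified, so that the induction hypothesis applies to the preceding
   ordinal. *)
case: j => k; elim: k => [|k IH] kN.
  by rewrite -[RHS]X0; congr submxcol; exact: val_inj.
have kN' : (k < N)%N by [].
rewrite /= (insubT (fun k => k < N)%N kN') -IH ?(ltnW kN) // => kN1.
rewrite (_ : Ordinal kN = next (Ordinal kN')); last exact: val_inj.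
rewrite XS (_ : cur (Ordinal kN') = Ordinal kN1) //; exact: val_inj.
Qed.

(** The system is triangular in time. Keeping [g], [gh] and [c] arbitrary covers both residuals as
    well as their derivative [lin_R]. *)
Lemma residual_unique_zero (x0 : 'cV[R]_nx)
    (g gh : 'I_N -> 'cV[R]_nx -> 'cV[R]_nu -> 'cV[R]_nx)
    (c : 'I_N -> 'cV[R]_nx -> 'cV[R]_nu) :
  exists y0, forall y,
    col_mx (stack_constraints (x0 - state (w_of y) ord0)
             (fun i => g i (x_ (w_of y) i) (control (w_of y) i)
                       - state (w_of y) (next i)))
      (col_mx (stack_constraints (x0 - state (what_of y) ord0)
             (fun i => gh i (x_ (what_of y) i) (control (what_of y) i)
                       - state (what_of y) (next i)))
        (\mxcol_(i < N) (c i (x_ (what_of y) i) - control (what_of y) i))) = 0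
    <-> y = y0.
Proof.
(* The closed loop determines the hatted states, the feedback then gives the controls, and these
   drive the remaining states in open loop. *)
pose Xh := \mxcol_(j < N.+1) simulate (fun i x => gh i x (c i x)) x0 j.
pose U := \mxcol_(i < N) c i (submxcol Xh (cur i)).
pose X := \mxcol_(j < N.+1) simulate (fun i x => g i x (submxcol U i)) x0 j.
exists (col_mx X (col_mx Xh U)) => y; rewrite y_eqE.
set x := usubmx y; set xh := usubmx (dsubmx y); set u := dsubmx (dsubmx y).
have stW j : state (w_of y) j = submxcol x j by rewrite /state col_mxKu.
have coW i : control (w_of y) i = submxcol u i by rewrite /control col_mxKd.
have stWh j : state (what_of y) j = submxcol xh j by [].
have coWh i : control (what_of y) i = submxcol u i by [].
have zero_col m1 m2 (a : 'cV[R]_m1) (b : 'cV[R]_m2) :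
    col_mx a b = 0 <-> a = 0 /\ b = 0.
  split=> [E|[-> ->]]; last exact: col_mx0.
  by apply: eq_col_mx; rewrite E col_mx0.
rewrite !zero_col !stack_constraints_eq0.
split.
  case=> [[x0E xS] [[xh0E xhS] uE]].
  have uE' i : submxcol u i = c i (submxcol xh (cur i)).
    apply/esym/subr0_eq; move/(congr1 (fun M => submxcol M i)): uE.
    by rewrite mxcolK submxcol0.
  have xhXh : submxcol xh ord0 = x0 /\ forall i, submxcol xh (next i) =
      gh i (submxcol xh (cur i)) (c i (submxcol xh (cur i))).
    split=> [|i]; first exact/esym/subr0_eq.
    by rewrite -uE'; exact/esym/subr0_eq.
  have uU : u = U.
    apply/mxcolP => i; rewrite mxcolK uE'.
    by rewrite ((simulate_unique (fun i x => gh i x (c i x)) x0 xh).1 xhXh).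
  split=> //; last exact: (simulate_unique (fun i x => gh i x (c i x)) x0 xh).1.
  apply/(simulate_unique (fun i x => g i x (submxcol U i)) x0 x).
  split=> [|i]; first by rewrite -stW; exact/esym/subr0_eq.
  by rewrite -uU -!stW -coW; exact/esym/subr0_eq.
case=> /simulate_unique [x0E xS] /[dup] xhXh /simulate_unique [xh0E xhS] uE.
have uE' i : submxcol u i = c i (submxcol xh (cur i)).
  by rewrite uE mxcolK xhXh.
split.
  split=> [|i]; first by rewrite stW x0E subrr.
  by rewrite /x_ !stW coW xS uE subrr.
split.
  split=> [|i]; first by rewrite stWh xh0E subrr.
  by rewrite /x_ !stWh coWh xhS uE' subrr.
apply/mxcolP => i; rewrite mxcolK submxcol0.
by rewrite /x_ stWh coWh uE' subrr.
Qed.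

End ForwardSimulation.

(** * Derivatives of the residuals *)

Section Derivatives.
Context {R : realType} {N nx nu : nat} (P : ocp R N nx nu).
Local Notation nX := (\sum_(i < N.+1) nx)%N.
Local Notation nU := (\sum_(i < N) nu)%N.
Local Notation nW := (nX + nU)%N.
Local Notation nY := (nX + (nX + nU))%N.
Implicit Types (i : 'I_N) (j : 'I_N.+1) (w wb v : 'cV[R]_nW).
Implicit Types (y yb dy : 'cV[R]_nY).

Lemma state_linear j : linear (fun w => state w j).
Proof. by move=> a w v; apply/matrixP => k l; rewrite !mxE. Qed.

Lemma control_linear i : linear (fun w => control w i).
Proof. by move=> a w v; apply/matrixP => k l; rewrite !mxE. Qed.

Lemma xu_linear i : linear (fun w => xu_ w i).
Proof.
move=> a w v; rewrite /xu_ /x_ state_linear control_linear.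
by rewrite scale_col_mx add_col_mx.
Qed.

Lemma w_of_linear : linear (@w_of R N nx nu).
Proof.
by move=> a y yb; rewrite /w_of !linearP scale_col_mx add_col_mx.
Qed.

Lemma what_of_linear : linear (@what_of R N nx nu).
Proof. exact: linearP. Qed.

Lemma y_of_linear : linear (@y_of R N nx nu).
Proof.
by move=> a w v; rewrite /y_of !linearP scale_col_mx add_col_mx.
Qed.

Lemma w_of_y_of w : w_of (y_of w) = w.
Proof. by rewrite /w_of /y_of col_mxKu col_mxKd vsubmxK. Qed.

Lemma what_of_y_of w : what_of (y_of w) = w.
Proof. exact: col_mxKd. Qed.

Lemma is_derive_stack n (c0 : 'cV[R]_n -> 'cV[R]_nx)
    (c : 'cV[R]_n -> 'I_N -> 'cV[R]_nx) (z v : 'cV[R]_n) (dc0 : 'cV[R]_nx)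
    (dc : 'I_N -> 'cV[R]_nx) :
  is_derive z v c0 dc0 -> (forall i, is_derive z v (c ^~ i) (dc i)) ->
  is_derive z v (fun t => stack_constraints (c0 t) (c t))
    (stack_constraints dc0 dc).
Proof.
move=> H0 H; apply: (@is_derive_mxcol _ _ _ (fun=> nx)) => j.
by case: (unlift ord0 j).
Qed.

Lemma jac_xu_mulmx wb i v :
  jac (dyn P i) (xu_ wb i) *m xu_ v i =
  A_ P wb i *m x_ v i + B_ P wb i *m control v i.
Proof. by rewrite -mul_row_col hsubmxK. Qed.

(* Common linearization of [F] at [wb] and of [Fhat P ^~ wb] anywhere. *)
Definition lin_F wb v : 'cV[R]_nX :=
  stack_constraints (0 - state v ord0)
    (fun i => A_ P wb i *m x_ v i + B_ P wb i *m control v i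
              - state v (next i)).

Lemma is_derive_initial w v :
  is_derive w v (fun t => x_init P - state t ord0) (0 - state v ord0).
Proof.
apply: is_deriveB; exact: is_derive_linear_cV (state_linear _).
Qed.

Lemma is_derive_F w v : (forall i, differentiable (dyn P i) (xu_ w i)) ->
  is_derive w v (F P) (lin_F w v).
Proof.
move=> dd; apply: is_derive_stack => [|i]; first exact: is_derive_initial.
rewrite -jac_xu_mulmx; apply: is_deriveB.
  apply: (is_derive_comp_linear (xu_linear i)).
  by rewrite (jac_mulmx _ (dd i)); exact/derivableP/diff_derivable.
exact: is_derive_linear_cV (state_linear _).
Qed.

Lemma affine_regroup1 (U : zmodType) (e a b c : U) :
  e + (a - b) - c = e - b + (a - c).
Proof. by rewrite [a - b]addrC addrA -!addrA. Qed.

Lemma affine_regroup (U : zmodType) (e a b c d s : U) :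
  e + (a - b) + (c - d) - s = e - b - d + (a + c - s).
Proof.
by rewrite affine_regroup1 [a - b]addrC !addrA [e - b - d + a]addrAC.
Qed.

Lemma is_derive_Fhat wb w v :
  is_derive w v (fun t => Fhat P t wb) (lin_F wb v).
Proof.
apply: is_derive_stack => [|i]; first exact: is_derive_initial.
apply: (@is_derive_affine _ _ _ _ (fun v => A_ P wb i *m x_ v i
  + B_ P wb i *m control v i - state v (next i))
  (fbar_ P wb i - A_ P wb i *m x_ wb i - B_ P wb i *m control wb i)).
  by move=> t; rewrite !mulmxBr; exact: affine_regroup.
apply: linear_addf; last exact/linear_oppf/state_linear.
apply: linear_addf; first exact/linear_mulmxf/state_linear.
exact/linear_mulmxf/control_linear.
Qed.

Definition lin_G wb v : 'cV[R]_nU :=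
  \mxcol_(i < N) (K_ P wb i *m x_ v i - control v i).

Lemma is_derive_G wb w v : is_derive w v (fun t => G P t wb) (lin_G wb v).
Proof.
apply: (@is_derive_mxcol _ _ _ (fun=> nu)) => i.
apply: (@is_derive_affine _ _ _ _ (fun v => K_ P wb i *m x_ v i - control v i)
  (control wb i + k_ P wb i - K_ P wb i *m x_ wb i)).
  by move=> t; rewrite mulmxBr; exact: affine_regroup1.
apply: linear_addf; last exact/linear_oppf/control_linear.
exact/linear_mulmxf/state_linear.
Qed.

(** The derivative in the unknown shared by both residuals: of the affine [R_MS] at any point, and
    of [R_SS] at the linearization point itself. *)
Definition lin_R wb dy : 'cV[R]_nY :=
  col_mx (lin_F wb (w_of dy))
    (col_mx (lin_F wb (what_of dy)) (lin_G wb (what_of dy))).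

Lemma is_derive_feedback wb y dy :
  is_derive y dy
    (fun t => col_mx (Fhat P (what_of t) wb) (G P (what_of t) wb))
    (col_mx (lin_F wb (what_of dy)) (lin_G wb (what_of dy))).
Proof.
apply: is_derive_col_mx.
  apply: (is_derive_comp_linear (f := fun w => Fhat P w wb) what_of_linear).
  exact: is_derive_Fhat.
apply: (is_derive_comp_linear (f := fun w => G P w wb) what_of_linear).
exact: is_derive_G.
Qed.

Lemma is_derive_R_MS wb y dy :
  is_derive y dy (fun t => R_MS P t (y_of wb)) (lin_R wb dy).
Proof.
apply: is_derive_col_mx; rewrite w_of_y_of.
  apply: (is_derive_comp_linear (f := fun w => Fhat P w wb) w_of_linear).
  exact: is_derive_Fhat.
exact: is_derive_feedback.
Qed.

Lemma is_derive_R_SS w dy : (forall i, differentiable (dyn P i) (xu_ w i)) ->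
  is_derive (y_of w) dy (fun t => R_SS P t (y_of w)) (lin_R w dy).
Proof.
move=> dd; apply: is_derive_col_mx.
  apply: (is_derive_comp_linear (f := F P) w_of_linear); rewrite w_of_y_of.
  exact: is_derive_F.
rewrite w_of_y_of; exact: is_derive_feedback.
Qed.

Lemma is_derive_Fhat_param w v : (forall i, C1_near (dyn P i) (xu_ w i)) ->
  is_derive w v (fun t => Fhat P w t) 0.
Proof.
move=> C1d.
have -> : (0 : 'cV[R]_nX) = stack_constraints 0 (fun=> 0).
  by apply/esym/stack_constraints_eq0.
apply: is_derive_stack => i.
rewrite -[X in is_derive _ _ _ X]subr0.
apply: is_deriveB.
(* Each block is the linearization of [dyn P i] at the moving point [xu_ t i], evaluated at the
   fixed point [xu_ w i]. *)
have E : (fun t => fbar_ P t i + A_ P t i *m (x_ w i - x_ t i)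
                   + B_ P t i *m (control w i - control t i)) =
  (fun z => dyn P i z + jac (dyn P i) z *m (xu_ w i - z)) \o (fun t => xu_ t i).
  apply/funext => t; rewrite /= -addrA; congr (_ + _).
  rewrite -mul_row_col hsubmxK; congr (_ *m _).
  by rewrite opp_col_mx add_col_mx.
rewrite E; apply: (is_derive_comp_linear (xu_linear i)).
exact: is_derive_linearization_point.
Qed.

(** The Riccati gains depend on the parameter only in the blocks common to both residuals. These
    cancel in the difference [d], so their derivatives are never computed. *)
Lemma derive_R_SS_param w dy :
  (forall i, C1_near (dyn P i) (xu_ w i)) ->
  derivable (fun t => R_MS P (y_of w) t) (y_of w) dy ->
  'D_dy (fun t => R_SS P (y_of w) t) (y_of w)
    = 'D_dy (fun t => R_MS P (y_of w) t) (y_of w).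
Proof.
move=> C1d dMS.
pose d t : 'cV[R]_nY := col_mx (F P w - Fhat P w (w_of t)) 0.
have dd : is_derive (y_of w) dy d 0.
  have -> : (0 : 'cV[R]_nY) = col_mx (0 - 0) 0 by rewrite subr0 !col_mx0.
  apply: is_derive_col_mx; apply: is_deriveB.
  apply: (is_derive_comp_linear (f := fun t => Fhat P w t) w_of_linear).
  by rewrite w_of_y_of; exact: is_derive_Fhat_param.
have -> : (fun t => R_SS P (y_of w) t) = (fun t => R_MS P (y_of w) t) + d.
  apply/funext => t; rewrite /R_SS /d w_of_y_of.
  rewrite -[RHS]/(R_MS P (y_of w) t + d t) /R_MS /d w_of_y_of.
  by rewrite add_col_mx addrC subrK addr0.
have [dex dE] := dd.
by rewrite (deriveD dMS dex) dE addr0.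
Qed.

End Derivatives.

(** * KKT points and the Riccati recursion *)

Section RiccatiStep.
Context {R : realType} {n m : nat}.
Variables (A Q Pn : 'M[R]_n) (B : 'M[R]_(n, m)) (S : 'M[R]_(m, n)).
Variables (T : 'M[R]_m).
Variables (q p a x : 'cV[R]_n) (r u : 'cV[R]_m).
(** [T] plays the part of the control weight [R_]. The pair [Pn], [p] belongs to the next stage, and
    [lam] is the costate there, at the successor state [a + A x + B u]. *)
Let Lam := T + B^T *m Pn *m B.
Let M := S + B^T *m Pn *m A.
Let h := r + B^T *m (Pn *m a + p).
Let K := - invmx Lam *m M.
Let lam := Pn *m (a + A *m x + B *m u) + p.

Lemma sum_regroup (U : zmodType) (e s t b c d : U) :
  e + s + t + (b + (c + d)) = (e + b) + ((s + c) + (t + d)).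
Proof. by rewrite -[e + s + t]addrA addrACA [s + t + _]addrACA. Qed.

Lemma mulmx_costate k (C : 'M[R]_(k, n)) :
  C *m lam =
  C *m (Pn *m a + p) + (C *m Pn *m A *m x + C *m Pn *m B *m u).
Proof.
by rewrite /lam !mulmxDr !mulmxA -!addrA; congr (_ + _); rewrite addrA addrC.
Qed.

Hypotheses (symP : Pn^T = Pn) (symQ : Q^T = Q) (symT : T^T = T).
Hypothesis Lam_unit : Lam \in unitmx.

Let M_tr : S^T + A^T *m Pn *m B = M^T.
Proof. by rewrite linearD /= !trmx_mul trmxK symP mulmxA. Qed.

Let K_tr : K^T = - (M^T *m invmx Lam).
Proof.
have symLam : Lam^T = Lam.
  by rewrite /Lam linearD /= !trmx_mul trmxK symP symT mulmxA.
by rewrite /K mulNmx linearN /= trmx_mul trmx_inv symLam.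
Qed.

Hypothesis stat_u : r + S *m x + T *m u + B^T *m lam = 0.

(** Substituting [lam] into the stationarity in [u] gives [Lam u = - (M x + h)], which is solved for
    [u]. *)
Lemma riccati_feedback : u = K *m x + - invmx Lam *m h.
Proof.
move: stat_u; rewrite mulmx_costate sum_regroup -!mulmxDl.
rewrite -/h -/M -/Lam => E.
have {}E : Lam *m u = - (M *m x + h).
  by apply/eqP; rewrite -addr_eq0 addrC [M *m x + h]addrC -addrA E.
by rewrite -[u](mulKmx Lam_unit) E mulmxN mulmxDr opprD -!mulNmx mulmxA.
Qed.

(** Inserting the feedback into [M^T u] yields [M^T K x - M^T Lam^-1 h]; symmetry of [Lam] turns the
    last term into [K^T h]. *)
Lemma riccati_costate :
  q + Q *m x + S^T *m u + A^T *m lam =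
  (Q + A^T *m Pn *m A + (S^T + A^T *m Pn *m B) *m K) *m x
  + (q + A^T *m (Pn *m a + p) + K^T *m h).
Proof.
rewrite mulmx_costate sum_regroup -!mulmxDl.
rewrite {1}riccati_feedback M_tr K_tr [in RHS]mulmxDl.
rewrite [M^T *m (_ + _)]mulmxDr !mulNmx !mulmxN !mulmxA.
by rewrite addrA [X in X + _ = _]addrC addrACA.
Qed.

(** The correction term equals [- M^T Lam^-1 M], which is symmetric. *)
Lemma riccati_sym :
  (Q + A^T *m Pn *m A + (S^T + A^T *m Pn *m B) *m K)^T =
  Q + A^T *m Pn *m A + (S^T + A^T *m Pn *m B) *m K.
Proof.
rewrite M_tr linearD /= [(_ *m K)^T]trmx_mul K_tr trmxK.
rewrite linearD /= symQ !trmx_mul trmxK symP mulmxA /K.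
by rewrite !mulNmx mulmxN mulmxA.
Qed.

End RiccatiStep.

(** * Stagewise stationarity and the costates at a KKT point *)

Section KKTConditions.
Context {R : realType} {N nx nu : nat} (P : ocp R N nx nu).
Local Notation nX := (\sum_(i < N.+1) nx)%N.
Local Notation nU := (\sum_(i < N) nu)%N.
Local Notation nW := (nX + nU)%N.
Local Notation nY := (nX + (nX + nU))%N.
Variables (w : 'cV[R]_nW) (lam : 'cV[R]_nX).
Implicit Types (i : 'I_N) (j : 'I_N.+1) (v : 'cV[R]_nW).

Hypothesis diff_dyn : forall i, differentiable (dyn P i) (xu_ w i).
Hypothesis diff_stage : forall i, differentiable (stage_cost P i) (xu_ w i).
Hypothesis diff_final : differentiable (final_cost P) (state w ord_max).
Hypothesis diff_F : differentiable (F P) w.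
Hypothesis kkt : KKT P w lam.

Let stage_sum : V P =
  (\sum_(i < N) (fun t => stage_cost P i (xu_ t i)))
  + (fun t => final_cost P (state t ord_max)).
Proof. by apply/funext => t; rewrite /V fctE fct_sumE. Qed.

Lemma differentiable_V : differentiable (V P) w.
Proof.
rewrite stage_sum; apply: differentiableD.
  apply: differentiable_sum => i.
  apply: (@differentiable_comp _ _ _ _ (fun t => xu_ t i)) => //.
  exact/differentiable_linear_cV/xu_linear.
apply: (@differentiable_comp _ _ _ _ (fun t => state t ord_max)) => //.
exact/differentiable_linear_cV/state_linear.
Qed.

Lemma is_derive_V v :
  is_derive w v (V P)
    (\sum_(i < N) 'D_(xu_ v i) (stage_cost P i) (xu_ w i)
     + 'D_(state v ord_max) (final_cost P) (state w ord_max)).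
Proof.
rewrite stage_sum; apply: is_deriveD.
  apply: is_derive_sum => i.
  apply: (is_derive_comp_linear (f := stage_cost P i) (xu_linear i)).
  exact/derivableP/diff_derivable.
apply: (is_derive_comp_linear (f := final_cost P) (state_linear ord_max)).
exact/derivableP/diff_derivable.
Qed.

(** Gradient in the stage variables of the Hamiltonian, stage cost plus next costate times
    dynamics. *)
Let mu i := grad (stage_cost P i) (xu_ w i)
  + (jac (dyn P i) (xu_ w i))^T *m submxcol lam (next i).

Let oppmx11 (A : 'M[R]_1) : (- A) 0 0 = - A 0 0.
Proof. by rewrite mxE. Qed.

Let addmx11 (A B : 'M[R]_1) : (A + B) 0 0 = A 0 0 + B 0 0.
Proof. by rewrite mxE. Qed.

Let zeromx11 : (0 : 'M[R]_1) 0 0 = 0.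
Proof. by rewrite mxE. Qed.

(** Stationarity of the Lagrangian tested against [v] and sorted by stage; the right side collects
    the terms in which the states enter the constraints with a minus sign. *)
Lemma KKT_direction v :
  \sum_(i < N) ((mu i)^T *m xu_ v i) 0 0
  + ((grad (final_cost P) (state w ord_max))^T *m state v ord_max) 0 0
  = \sum_(j < N.+1) ((submxcol lam j)^T *m state v j) 0 0.
Proof.
have [_ st] := kkt.
have E : 'D_v (V P) w + (lam^T *m 'D_v (F P) w) 0 0 = 0.
  have := congr1 (fun M : 'cV[R]_nW => (M^T *m v) 0 0) st.
  rewrite linearD /= mulmxDl trmx_mul trmxK -mulmxA trmx0 mul0mx.
  rewrite (jac_mulmx _ diff_F) [X in X = _]mxE [RHS]mxE => <-.
  by rewrite -(grad_mulmx _ differentiable_V).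
move: E; have [_ ->] := is_derive_V v; have [_ ->] := is_derive_F v diff_dyn.
rewrite /lin_F mulmx_tr_stack -(grad_mulmx _ diff_final).
under eq_bigr do rewrite -(grad_mulmx _ (diff_stage _)).
rewrite addmx11 summxE sub0r mulmxN oppmx11.
under [X in _ + (_ + X)]eq_bigr do
  rewrite -jac_xu_mulmx mulmxBr addmx11 oppmx11.
rewrite sumrB big_ord_recl.
under [X in _ -> X + _ = _]eq_bigr do
  rewrite linearD /= mulmxDl addmx11 trmx_mul trmxK -mulmxA.
rewrite big_split /= => E.
apply/eqP; rewrite -subr_eq0; apply/eqP; rewrite -[RHS]E.
(* Unfolding exposes [lift ord0], the index form produced by [big_ord_recl]. *)
by rewrite /Defs.next; ring.
Qed.

(** Test directions supported in a single block, each isolating one condition from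
    [KKT_direction]. *)
Let state_bump j (a : 'cV[R]_nx) : 'cV[R]_nW :=
  col_mx (\mxcol_(k < N.+1) (if k == j then a else 0)) 0.
Let control_bump i (b : 'cV[R]_nu) : 'cV[R]_nW :=
  col_mx 0 (\mxcol_(k < N) (if k == i then b else 0)).

Let state_state_bump j a k : state (state_bump j a) k = if k == j then a else 0.
Proof. by rewrite /state col_mxKu mxcolK. Qed.

Let control_state_bump j a i : control (state_bump j a) i = 0.
Proof. by rewrite /control col_mxKd submxcol0. Qed.

Let state_control_bump i b k : state (control_bump i b) k = 0.
Proof. by rewrite /state col_mxKu submxcol0. Qed.

Let control_control_bump i b k :
  control (control_bump i b) k = if k == i then b else 0.
Proof. by rewrite /control col_mxKd mxcolK. Qed.

Lemma dot_inj n (a b : 'cV[R]_n) :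
  (forall d : 'cV[R]_n, (a^T *m d) 0 0 = (b^T *m d) 0 0) -> a = b.
Proof.
move=> H; apply/colP => k; have := H (delta_mx k 0).
by rewrite -!colE !mxE.
Qed.

Let sum_state_bump j a :
  \sum_(k < N.+1) ((submxcol lam k)^T *m state (state_bump j a) k) 0 0 =
  ((submxcol lam j)^T *m a) 0 0.
Proof.
rewrite (bigD1 j) //= state_state_bump eqxx big1 ?addr0 // => k kj.
by rewrite state_state_bump (negPf kj) mulmx0 mxE.
Qed.

Lemma stationary_final :
  submxcol lam ord_max = grad (final_cost P) (state w ord_max).
Proof.
apply: dot_inj => d; have := KKT_direction (state_bump ord_max d).
rewrite sum_state_bump => <-.
rewrite big1 ?add0r ?state_state_bump ?eqxx // => i _.
rewrite /xu_ /x_ control_state_bump state_state_bump.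
rewrite (_ : (cur i == ord_max) = false) ?col_mx0 ?mulmx0 ?mxE //.
by apply/negbTE; rewrite neq_ltn /= ltn_ord.
Qed.

Lemma stationary_state i :
  submxcol lam (cur i) = usubmx (grad (stage_cost P i) (xu_ w i))
    + (A_ P w i)^T *m submxcol lam (next i).
Proof.
apply: dot_inj => d; have := KKT_direction (state_bump (cur i) d).
rewrite sum_state_bump => <-.
rewrite state_state_bump (_ : (ord_max == cur i) = false); last first.
  by apply/negbTE; rewrite eq_sym neq_ltn /= ltn_ord.
rewrite mulmx0 zeromx11 addr0 (bigD1 i) //= big1; last first.
  move=> k ki; rewrite /xu_ /x_ control_state_bump state_state_bump.
  rewrite (_ : (cur k == cur i) = false) ?col_mx0 ?mulmx0 ?mxE //.
  by apply: contra_neqF ki => /eqP [] /val_inj.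
rewrite addr0 /xu_ /x_ control_state_bump state_state_bump eqxx.
rewrite -[mu i]vsubmxK tr_col_mx mul_row_col mulmx0 addr0.
by rewrite /mu [usubmx (_ + _)]linearD /= -mul_usub_mx -trmx_lsub.
Qed.

Lemma stationary_control i :
  dsubmx (grad (stage_cost P i) (xu_ w i))
    + (B_ P w i)^T *m submxcol lam (next i) = 0.
Proof.
apply: dot_inj => d; have := KKT_direction (control_bump i d).
rewrite [RHS]big1 => [|k _]; last by rewrite state_control_bump mulmx0 mxE.
rewrite state_control_bump mulmx0 zeromx11 addr0.
rewrite trmx0 mul0mx zeromx11 => <-.
rewrite (bigD1 i) //= big1 => [|k ki]; last first.
  rewrite /xu_ /x_ control_control_bump state_control_bump (negPf ki).
  by rewrite col_mx0 mulmx0 mxE.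
rewrite addr0 /xu_ /x_ control_control_bump state_control_bump eqxx.
rewrite -[mu i]vsubmxK tr_col_mx mul_row_col mulmx0 add0r.
by rewrite /mu [dsubmx (_ + _)]linearD /= -mul_dsub_mx -trmx_rsub.
Qed.

Hypothesis C2_stage : forall i, C2_near (stage_cost P i) (xu_ w i).
Hypothesis C2_final : C2_near (final_cost P) (state w ord_max).
Hypothesis Lambda_unit : forall i, Lambda_ P w i \in unitmx.

Lemma KKT_dynamics i : state w (next i) =
  a_ P w i + A_ P w i *m x_ w i + B_ P w i *m control w i.
Proof.
have [/stack_constraints_eq0 [_ /(_ i) E] _] := kkt.
rewrite -(subr0_eq E) -[LHS]/(fbar_ P w i) /a_.
by rewrite [RHS]addrAC !subrK.
Qed.

Lemma Q_sym i : (Q_ P w i)^T = Q_ P w i.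
Proof. by rewrite /Q_ trmx_ulsub (hess_sym (C2_stage i)). Qed.

Lemma R_sym i : (R_ P w i)^T = R_ P w i.
Proof. by rewrite /R_ trmx_drsub (hess_sym (C2_stage i)). Qed.

(** At the linearization point the quadratic model has the gradient of the true stage cost, by the
    choice of [r_]; thus stationarity of the nonlinear problem becomes that of the quadratic one. *)
Lemma quadratic_stationary_control i :
  submxcol lam (next i) = (riccati P w (next i)).1 *m state w (next i)
                          + (riccati P w (next i)).2 ->
  r_ P w i + S_ P w i *m x_ w i + R_ P w i *m control w i
  + (B_ P w i)^T *m ((riccati P w (next i)).1
       *m (a_ P w i + A_ P w i *m x_ w i + B_ P w i *m control w i)
     + (riccati P w (next i)).2) = 0.
Proof.
move=> lamE; rewrite -KKT_dynamics -lamE -[RHS](stationary_control i).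
by congr (_ + _); rewrite /r_ addrAC !subrK.
Qed.

(* The costate is the gradient of the quadratic cost-to-go along the solution. *)
Lemma riccati_KKT (j : 'I_N.+1) :
  (riccati P w j).1^T = (riccati P w j).1 /\
  submxcol lam j = (riccati P w j).1 *m state w j + (riccati P w j).2.
Proof.
(* Backward induction in time, run on the distance [d] to the horizon. *)
have [d Nd] : exists d, N = (j + d)%N.
  by exists (N - j)%N; rewrite subnKC // -ltnS.
elim: d j Nd => [|d IH] j.
  rewrite addn0 => Nj.
  have -> : j = ord_max by exact: val_inj.
  rewrite [nat_of_ord _]/= riccatiN /= (hess_sym C2_final) stationary_final.
  by rewrite /p_final addrC subrK.
move=> Nd; have jN : (j < N)%N.
  by rewrite [in X in (_ < X)%N]Nd addnS ltnS leq_addr.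
pose i := Ordinal jN.
have ji : j = cur i by exact: val_inj.
have [|symP lamP] := IH (next i); first by rewrite /= /bump add1n addSn -addnS.
rewrite (_ : riccati P w j = ric_step P w i (riccati P w (next i))); last first.
  exact: (riccatiS P w i).
have stat_u := quadratic_stationary_control lamP.
rewrite ji; split.
  exact: (riccati_sym (A_ P w i) (B_ P w i) (S_ P w i) symP (Q_sym i)
    (R_sym i)).
rewrite stationary_state lamP KKT_dynamics.
apply: (etrans _ (riccati_costate (Q_ P w i) (q_ P w i) symP (R_sym i)
  (Lambda_unit i) stat_u)).
(* By the choice of [q_], the linear model terms add up to the true gradient in the state. *)
by congr (_ + _); rewrite /q_ addrAC !subrK.
Qed.

Lemma k_KKT i : k_ P w i = 0.
Proof.
have [symP lamP] := riccati_KKT (next i).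
have uE := riccati_feedback (Lambda_unit i) (quadratic_stationary_control lamP).
apply/eqP; rewrite /k_ subr_eq0 addrC; apply/eqP; exact/esym/uE.
Qed.

End KKTConditions.

(** * Contraction rates *)

Section ContractionRate.
Context {R : realType} {N nx nu : nat} (P : ocp R N nx nu).
Local Notation nX := (\sum_(i < N.+1) nx)%N.
Local Notation nU := (\sum_(i < N) nu)%N.
Local Notation nW := (nX + nU)%N.
Local Notation nY := (nX + (nX + nU))%N.
Implicit Types (i : 'I_N) (w : 'cV[R]_nW) (y yb dy : 'cV[R]_nY).

Lemma R_MS_unique_zero yb : exists y0, forall y, R_MS P y yb = 0 <-> y = y0.
Proof.
pose g i x u := fbar_ P (w_of yb) i + A_ P (w_of yb) i *m (x - x_ (w_of yb) i)
  + B_ P (w_of yb) i *m (u - control (w_of yb) i).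
exact: (residual_unique_zero (x_init P) g g (fun i x =>
  control (w_of yb) i + k_ P (w_of yb) i
  + K_ P (w_of yb) i *m (x - x_ (w_of yb) i))).
Qed.

Lemma R_SS_unique_zero yb : exists y0, forall y, R_SS P y yb = 0 <-> y = y0.
Proof.
pose g i x u := fbar_ P (w_of yb) i + A_ P (w_of yb) i *m (x - x_ (w_of yb) i)
  + B_ P (w_of yb) i *m (u - control (w_of yb) i).
exact: (residual_unique_zero (x_init P) (fun i x u => dyn P i (col_mx x u)) g
  (fun i x => control (w_of yb) i + k_ P (w_of yb) i
  + K_ P (w_of yb) i *m (x - x_ (w_of yb) i))).
Qed.

(** [lin_R] is a closed-loop residual with zero initial state and linear dynamics and feedback, so
    its only zero is the trivial one. *)
Lemma lin_R_inj wb dy : lin_R P wb dy = 0 -> dy = 0.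
Proof.
pose g i (x : 'cV[R]_nx) (u : 'cV[R]_nu) := A_ P wb i *m x + B_ P wb i *m u.
have [y0 H] := residual_unique_zero 0 g g (fun i x => K_ P wb i *m x : 'cV[R]_nu).
(* As a value of a derivative, it vanishes in the zero direction. *)
have lin0 : lin_R P wb 0 = 0.
  have [ex <-] := is_derive_R_MS P wb 0 0.
  exact: derive0.
by move=> /H ->; apply/esym/H.
Qed.

Lemma well_posed_unique_zero n (res : 'cV[R]_n -> 'cV[R]_n -> 'cV[R]_n) z :
  (forall zb, exists t0, forall t, res t zb = 0 <-> t = t0) ->
  res z z = 0 -> jac_unknown res z \in unitmx -> well_posed_at res z.
Proof.
move=> H rz0 unit.
have sol zb t : res t zb = 0 <-> t = solution_map res zb.
  have [t0 Ht] := H zb.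
  have -> : solution_map res zb = t0.
    apply/Ht; apply: (@getPex _ [set z | res z zb = 0]).
    by exists t0; apply/Ht.
  exact: Ht.
split=> //.
  by apply: (@filterE _ (nbhs z) (nbhs_filter z)) => zb t; exact: sol.
exact/esym/sol.
Qed.

Lemma Fhat_diag w : Fhat P w w = F P w.
Proof.
rewrite /Fhat /F; congr stack_constraints; apply/funext => i.
by rewrite !subrr !mulmx0 !addr0.
Qed.

Lemma G_diag w : G P w w = \mxcol_(i < N) k_ P w i.
Proof.
apply: eq_mxcol => i.
by rewrite subrr mulmx0 addr0 addrAC subrr add0r.
Qed.

Lemma differentiable_unknown n (res : 'cV[R]_n -> 'cV[R]_n -> 'cV[R]_n) z :
  differentiable (fun t => res t.1 t.2) (z, z) ->
  differentiable (fun t => res t z) z.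
Proof.
move=> d; apply: (@differentiable_comp _ _ _ _ (fun t => (t, z))
  (fun t => res t.1 t.2)) => //.
Qed.

Lemma differentiable_param n (res : 'cV[R]_n -> 'cV[R]_n -> 'cV[R]_n) z :
  differentiable (fun t => res t.1 t.2) (z, z) ->
  differentiable (fun t => res z t) z.
Proof.
move=> d; apply: (@differentiable_comp _ _ _ _ (fun t => (z, t))
  (fun t => res t.1 t.2)) => //.
Qed.

(** A square matrix with trivial kernel is invertible; the transpose appears because [row_free]
    concerns left multiplication by rows. *)
Lemma jac_unknown_unit n (res : 'cV[R]_n -> 'cV[R]_n -> 'cV[R]_n) z :
  differentiable (fun t => res t z) z ->
  (forall v, 'D_v (fun t => res t z) z = 0 -> v = 0) ->
  jac_unknown res z \in unitmx.
Proof.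
move=> d inj; rewrite -unitmx_tr -row_free_unit; apply: inj_row_free => v.
move=> /(congr1 trmx); rewrite trmx_mul trmxK trmx0 => E.
by apply: trmx_inj; rewrite trmx0; apply: inj; rewrite -jac_mulmx.
Qed.

(** [F] is the top block of [R_SS] along the linear embedding [y_of], so it inherits the smoothness
    of the residual. *)
Lemma differentiable_F w :
  differentiable (fun t => R_SS P t (y_of w)) (y_of w) ->
  differentiable (F P) w.
Proof.
move=> d.
have -> : F P = usubmx \o ((fun t => R_SS P t (y_of w)) \o @y_of R N nx nu).
  by apply/funext => t; rewrite /= col_mxKu w_of_y_of.
apply: differentiable_comp; last exact/differentiable_linear_cV/linearP.
apply: differentiable_comp => //.
exact/differentiable_linear_cV/y_of_linear.
Qed.

End ContractionRate.

Theorem proposition3 (R : realType) (N nx nu : nat) (P : ocp R N nx nu)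
    (wstar : 'cV[R]_(\sum_(i < N.+1) nx + \sum_(i < N) nu))
    (lamstar : 'cV[R]_(\sum_(i < N.+1) nx)) :
  (0 < N)%N ->
  (forall i : 'I_N, convex_function setT (stage_cost P i)) ->
  convex_function setT (final_cost P) ->
  smooth_data P wstar ->
  C2_near (fun t => R_SS P t.1 t.2) (y_of wstar, y_of wstar) ->
  C2_near (fun t => R_MS P t.1 t.2) (y_of wstar, y_of wstar) ->
  KKT P wstar lamstar -> LICQ P wstar -> SOSC P wstar lamstar ->
  (forall i : 'I_N, Lambda_ P wstar i \in unitmx) ->
  [/\ well_posed_at (R_MS P) (y_of wstar),
      well_posed_at (R_SS P) (y_of wstar)
    & contraction_rate (R_MS P) (y_of wstar) = contraction_rate (R_SS P) (y_of wstar)].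
Proof.
move=> _ _ _ [smooth C2final] [C1SS _] [C1MS _] kkt _ _ unitL.
have C1dyn i : C1_near (dyn P i) (xu_ wstar i) by have [[]] := smooth i.
have C2stage i : C2_near (stage_cost P i) (xu_ wstar i) by have [] := smooth i.
have ddyn i := C1_near_differentiable (C1dyn i).
have dstage i := C1_near_differentiable (C2stage i).1.
have dfinal := C1_near_differentiable C2final.1.
have dSS := C1_near_differentiable C1SS.
have dMS := C1_near_differentiable C1MS.
have dSSu := differentiable_unknown dSS.
have dMSu := differentiable_unknown dMS.
have dF := differentiable_F dSSu.
have F0 : F P wstar = 0 by case: kkt.
(* On the diagonal [G] is the stack of the corrections [k_], which vanish at the KKT point. *)
have G0 : G P wstar wstar = 0.
  rewrite G_diag; apply/mxcolP => i; rewrite mxcolK submxcol0.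
  exact: (k_KKT ddyn dstage dfinal dF kkt C2stage C2final unitL).
have MS0 : R_MS P (y_of wstar) (y_of wstar) = 0.
  by rewrite /R_MS w_of_y_of what_of_y_of Fhat_diag F0 G0 !col_mx0.
have SS0 : R_SS P (y_of wstar) (y_of wstar) = 0.
  by rewrite /R_SS w_of_y_of what_of_y_of Fhat_diag F0 G0 !col_mx0.
have DMS dy := @derive_val _ _ _ _ _ _ _ (is_derive_R_MS P wstar (y_of wstar) dy).
have DSS dy := @derive_val _ _ _ _ _ _ _ (is_derive_R_SS dy ddyn).
split.
- apply: well_posed_unique_zero MS0 _; first exact: R_MS_unique_zero.
  apply: jac_unknown_unit dMSu _ => dy; rewrite DMS; exact: lin_R_inj.
- apply: well_posed_unique_zero SS0 _; first exact: R_SS_unique_zero.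
  apply: jac_unknown_unit dSSu _ => dy; rewrite DSS; exact: lin_R_inj.
have Ju : jac_unknown (R_MS P) (y_of wstar) = jac_unknown (R_SS P) (y_of wstar).
  apply: jac_eq dMSu dSSu _ => dy; exact: etrans (DMS dy) (esym (DSS dy)).
have Jp : jac_param (R_MS P) (y_of wstar) = jac_param (R_SS P) (y_of wstar).
  apply: jac_eq (differentiable_param dMS) (differentiable_param dSS) _ => dy.
  (* The assumed smoothness of the residual supplies this derivative, including its part through the
     Riccati recursion. *)
  have dp : derivable (fun t => R_MS P (y_of wstar) t) (y_of wstar) dy.
    exact: diff_derivable (differentiable_param dMS).
  exact: (esym (derive_R_SS_param C1dyn dp)).
by rewrite /contraction_rate /iteration_jac Ju Jp.
Qed.
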